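(* Given a temporal Heyting algebra $A$, the following are equivalent: (1) $A$ is simple; (2) the set of $\mathsf{P}$-filters of $A$ is exactly $\{\{1\},A\}$; (3) $\mathrm{Spec}(A)$ is topo-connected.
   Context: Write $\mathsf{P}$ for the ''past diamond'' operator (black diamond). A temporal Heyting algebra is a Heyting algebra with operators $\Box,\mathsf{P}$ such that $\Box(a\wedge b)=\Box a\wedge\Box b$, $a\le\Box a$, $\Box a\le b\vee(b\to a)$, and $\mathsf{P}a\le b\iff a\le\Box b$. A $\mathsf{P}$-filter is a filter $F$ such that $a\to b\in F$ implies $\mathsf{P}a\to\mathsf{P}b\in F$. $\mathrm{Spec}(A)$ is the space of prime filters ordered by inclusion, with topology generated by $\pi a=\{x:a\in x\}$ and complements, $xR^{\rhd}y$ iff $\forall a(\Box a\in x\Rightarrow a\in y)$, $xR^{\lhd}w$ iff $\forall a(a\in w\Rightarrow\mathsf{P}a\in x)$. A subset $S$ is archival if $x\notin S$, $z\in S$, $zR^{\lhd}x$ imply $R^{\lhd}[z]\cap{\uparrow}x\cap S\ne\varnothing$. For points $x,y$ of such a space, $y$ is topo-reachable from $x$ if $y$ belongs to every closed archival upset containing $x$; the space is topo-connected if every point is topo-reachable from every point. *)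

(* Defs.v *)
From HB Require Import structures.
From mathcomp Require Import all_boot all_order.
From mathcomp Require Import all_classical.
From mathcomp Require Import topology_structure.

Set Implicit Arguments.
Unset Strict Implicit.
Unset Printing Implicit Defensive.

Import Order.Theory.
Local Open Scope order_scope.
Local Open Scope classical_set_scope.

(* In this file the backquoted binary operations are lattice operations when
   annotated with %O, and set operations otherwise. *)

(* Distributivity is not assumed: it follows from residuation. *)
HB.mixin Record TBLattice_isHeyting (d : Order.disp_t) (T : Type)
    & Order.TBLattice d T := {
  himp : T -> T -> T;
  himpP : forall a b c : T, ((c `&` a)%O <= b) = (c <= himp a b)
}.

#[short(type="heytingType")]
HB.structure Definition Heyting (d : Order.disp_t) :=
  { T of Order.TBLattice d T & TBLattice_isHeyting d T }.

HB.mixin Record Heyting_isTemporal (d : Order.disp_t) (T : Type)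
    & Heyting d T := {
  box : T -> T;
  pdia : T -> T;
  boxI : forall a b : T, box (a `&` b)%O = (box a `&` box b)%O;
  le_box : forall a : T, a <= box a;
  box_le : forall a b : T, box a <= (b `|` himp b a)%O;
  pdia_box : forall a b : T, (pdia a <= b) = (a <= box b)
}.

#[short(type="temporalHeytingType")]
HB.structure Definition TemporalHeyting (d : Order.disp_t) :=
  { T of Heyting d T & Heyting_isTemporal d T }.

Section Algebra.
Context {d : Order.disp_t} {A : temporalHeytingType d}.

(* Compatibility with the constants 0 and 1 is reflexivity. *)
Record congruence (th : A -> A -> Prop) : Prop := Congruence {
  cong_refl : forall a, th a a;
  cong_sym : forall a b, th a b -> th b a;
  cong_trans : forall a b c, th a b -> th b c -> th a c;
  cong_meet : forall a a' b b',
    th a a' -> th b b' -> th (a `&` b)%O (a' `&` b')%O;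
  cong_join : forall a a' b b',
    th a a' -> th b b' -> th (a `|` b)%O (a' `|` b')%O;
  cong_himp : forall a a' b b',
    th a a' -> th b b' -> th (himp a b) (himp a' b');
  cong_box : forall a a', th a a' -> th (box a) (box a');
  cong_pdia : forall a a', th a a' -> th (pdia a) (pdia a')
}.

(* The improper filter setT is a filter. *)
Record lattice_filter (F : set A) : Prop := LatticeFilter {
  lfilter_top : F \top;
  lfilter_up : forall a b, a <= b -> F a -> F b;
  lfilter_meet : forall a b, F a -> F b -> F (a `&` b)%O
}.

Definition P_filter (F : set A) : Prop :=
  lattice_filter F /\
  forall a b, F (himp a b) -> F (himp (pdia a) (pdia b)).

Definition prime_filter (F : set A) : Prop :=
  [/\ lattice_filter F, ~ F \bot &
      forall a b, F (a `|` b)%O -> F a \/ F b].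

End Algebra.

(* Con(A) = {Delta, Nabla}; the one-element algebra counts as simple. *)
Definition simple_algebra (d : Order.disp_t) (A : temporalHeytingType d) : Prop :=
  [set th : A -> A -> Prop | congruence th] =
  [set (fun a b => a = b); (fun _ _ => True)].

Record Spec (d : Order.disp_t) (A : temporalHeytingType d) : Type := MkSpec {
  spec_filter : set A;
  spec_filter_prime : prime_filter spec_filter
}.

HB.instance Definition _ (d : Order.disp_t) (A : temporalHeytingType d) :=
  gen_eqMixin (Spec A).
HB.instance Definition _ (d : Order.disp_t) (A : temporalHeytingType d) :=
  gen_choiceMixin (Spec A).

Section Spectrum.
Context {d : Order.disp_t} {A : temporalHeytingType d}.

Definition spec_pi (a : A) : set (Spec A) := [set x | spec_filter x a].

Definition spec_subbase : set (set (Spec A)) :=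
  [set U | exists a : A, U = spec_pi a \/ U = ~` spec_pi a].

HB.instance Definition _ :=
  isSubBaseTopological.Build (Spec A) spec_subbase id.

Definition spec_le (x y : Spec A) : Prop := spec_filter x `<=` spec_filter y.

Definition spec_Rfut (x y : Spec A) : Prop :=
  forall a : A, spec_filter x (box a) -> spec_filter y a.

Definition spec_Rpast (x w : Spec A) : Prop :=
  forall a : A, spec_filter w a -> spec_filter x (pdia a).

End Spectrum.

Section TopoReachability.
Context {X : topologicalType} (le Rpast : X -> X -> Prop).

Definition upset (S : set X) : Prop := forall x y, le x y -> S x -> S y.

Definition archival (S : set X) : Prop :=
  forall x z, ~ S x -> S z -> Rpast z x ->
    [set y | Rpast z y] `&` [set y | le x y] `&` S !=set0.

(* [topo_reachable x y] reads: y is topo-reachable from x. *)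
Definition topo_reachable (x y : X) : Prop :=
  forall S : set X, closed S -> archival S -> upset S -> S x -> S y.

Definition topo_connected : Prop := forall x y : X, topo_reachable x y.

End TopoReachability.

(* Main.v *)
(** A congruence [th] is determined by the P-filter of elements congruent to
    [\top], and a P-filter [F] by the closed archival upset of prime filters
    containing it.

    If [S] is a closed archival upset, the elements [a] with [S] included in
    [spec_pi a] form a P-filter.  Closedness of [S] enters as follows: a point
    outside [S] has a basic neighbourhood [spec_pi a] minus [spec_pi b] that
    misses [S], and then [himp a b] lies in every point of the upset [S]; no
    compactness of the spectrum is needed.  Conversely, archivality of the set
    of prime filters containing a P-filter [F] is the separation of the filter
    generated by [F] and a point [x] from the ideal of those [a] whose past
    diamond is not in [z]. *)

Require Import Defs.
From HB Require Import structures.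
From mathcomp Require Import all_boot all_order.
From mathcomp Require Import all_classical.
From mathcomp Require Import topology_structure.
From mathcomp Require Import finmap.

Set Implicit Arguments.
Unset Strict Implicit.
Unset Printing Implicit Defensive.

Import Order.Theory.

Local Open Scope order_scope.
Local Open Scope classical_set_scope.

(** * Residuation, adjunction and generated filters *)

Section HeytingFacts.
Context {d : Order.disp_t} {A : temporalHeytingType d}.
Implicit Types (a b c m : A) (F : set A).

Lemma himp_mp a b : ((himp a b `&` a)%O <= b).
Proof. by rewrite himpP. Qed.

Lemma himp_topP a b : (himp a b = \top) <-> a <= b.
Proof.
split=> [e|ab]; first by have := himp_mp a b; rewrite e meet1x.
by apply/eqP; rewrite -le1x -himpP meet1x.
Qed.

Lemma le_himp a b : b <= himp a b.
Proof. by rewrite -himpP leIl. Qed.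

Lemma himp_meet a b : (himp a b `&` a)%O = (a `&` b)%O.
Proof.
apply: le_anti; rewrite !lexI leIr himp_mp/= leIl andbT.
exact: le_trans (leIr _ _) (le_himp _ _).
Qed.

(** Distributivity: residuation moves m across, and what remains is the universal property of the
    join. *)
Lemma meet_join_le m a b c :
  (m `&` a)%O <= c -> (m `&` b)%O <= c -> (m `&` (a `|` b))%O <= c.
Proof.
by rewrite ![(m `&` _)%O]meetC !himpP leUx => -> ->.
Qed.

Lemma box_mono a b : a <= b -> box a <= box b.
Proof. by move=> /meet_idPl ab; rewrite -ab boxI leIr. Qed.

Lemma le_box_pdia a : a <= box (pdia a).
Proof. by rewrite -pdia_box. Qed.

Lemma pdia_mono a b : a <= b -> pdia a <= pdia b.
Proof. by move=> ab; rewrite pdia_box (le_trans ab)// le_box_pdia. Qed.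

Lemma pdia_join_le a b : pdia (a `|` b)%O <= (pdia a `|` pdia b)%O.
Proof. by rewrite pdia_box leUx -!pdia_box leUl leUr. Qed.

Lemma pdia_bot_le : pdia (\bot : A) <= \bot.
Proof. by rewrite pdia_box le0x. Qed.

(** Turns implications modulo F into inequalities with a parameter from F, so that derivations from
    F become order computations. *)
Lemma lfilter_himpP F a b : lattice_filter F ->
  F (himp a b) <-> exists2 f, F f & (f `&` a)%O <= b.
Proof.
move=> hF; split=> [h|[f Ff fab]]; first by exists (himp a b) => //; exact: himp_mp.
by apply: (lfilter_up hF) Ff; rewrite -himpP.
Qed.

Lemma lfilter_mp F a b : lattice_filter F -> F (himp a b) -> F a -> F b.
Proof.
move=> hF h Fa; apply: (lfilter_up hF) (lfilter_meet hF h Fa).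
exact: himp_mp.
Qed.

(** For lattice filters this is the filter generated by their union, possibly improper. *)
Definition filter_join (F G : set A) : set A :=
  [set c | exists f g, [/\ F f, G g & (f `&` g)%O <= c]].

Lemma filter_join_lfilter F G : lattice_filter F -> lattice_filter G ->
  lattice_filter (filter_join F G).
Proof.
move=> hF hG; split.
- by exists \top, \top; split; rewrite ?lex1//; apply: lfilter_top.
- move=> a b ab [f [g [Ff Gg fga]]].
  by exists f, g; split=> //; apply: le_trans ab.
- move=> a b [f [g [Ff Gg fga]]] [f' [g' [Ff' Gg' fga']]].
  exists (f `&` f')%O, (g `&` g')%O; split; try exact: lfilter_meet.
  by rewrite meetACA leI2.
Qed.

Lemma sub_filter_joinl F G : lattice_filter G -> F `<=` filter_join F G.
Proof.
by move=> hG f Ff; exists f, \top; split=> //; [exact: lfilter_top|rewrite meetx1].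
Qed.

Lemma sub_filter_joinr F G : lattice_filter F -> G `<=` filter_join F G.
Proof.
by move=> hF g Gg; exists \top, g; split=> //; [exact: lfilter_top|rewrite meet1x].
Qed.

Lemma principal_lfilter a : lattice_filter [set c | a <= c].
Proof.
split=> [|b c bc ab|b c ab ac] /=; rewrite ?lex1//; first exact: le_trans bc.
by rewrite lexI; apply/andP.
Qed.

End HeytingFacts.

(** * Prime filter theorem and existence of points *)

Section PrimeSeparation.
Context {d : Order.disp_t} {A : temporalHeytingType d}.
Implicit Types (a b c : A) (F : set A).

Record lattice_ideal (I : set A) : Prop := LatticeIdeal {
  lideal_bot : I \bot;
  lideal_down : forall a b, a <= b -> I b -> I a;
  lideal_join : forall a b, I a -> I b -> I (a `|` b)%O
}.

(* The family is made of the sets [G] such that [G `|` F] is a suitable filter,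
   so that it also contains the union of the empty chain. *)
Lemma maximal_disjoint_lfilter F (I : set A) :
  lattice_filter F -> F `&` I = set0 ->
  exists M, [/\ lattice_filter M, F `<=` M, M `&` I = set0 &
    forall N, lattice_filter N -> M `<=` N -> N `&` I = set0 -> N `<=` M].
Proof.
move=> hF FI.
pose Q G := lattice_filter (G `|` F) /\ (G `|` F) `&` I = set0.
have chainQ (C : set (set A)) : C `<=` Q -> total_on C subset ->
    Q (\bigcup_(X in C) X).
  move=> CQ Ctot; split; last first.
    apply/seteqP; split=> // a [[[G CG Ga]|Fa] Ia].
    - by have [_ <-] := CQ _ CG; split=> //; left.
    - by rewrite -FI.
  split.
  - by right; exact: lfilter_top.
  - move=> a b ab [[G CG Ga]|Fa]; last by right; exact: lfilter_up ab _.
    have [hG _] := CQ _ CG.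
    have [Gb|Fb] := lfilter_up hG ab (or_introl Ga); last by right.
    by left; exists G.
  (* Unless both elements lie in F, the chain condition puts them in one G ∪ F with G in the chain,
     and this is already a filter. *)
  - have inG G a b : C G -> (G `|` F) a -> (G `|` F) b ->
        (\bigcup_(X in C) X `|` F) (a `&` b)%O.
      move=> CG Ga Gb; have [hG _] := CQ _ CG.
      by have [?|?] := lfilter_meet hG Ga Gb; [left; exists G|right].
    move=> a b [[G CG Ga]|Fa] [[H CH Hb]|Fb].
    - have [GH|HG] := Ctot _ _ CG CH.
      + by apply: (inG H) => //; left => //; exact: GH.
      + by apply: (inG G) => //; left => //; exact: HG.
    - by apply: (inG G) => //; [left|right].
    - by apply: (inG H) => //; [right|left].
    - by right; exact: lfilter_meet.
have [G [[hG GI] Gmax]] := Zorn_bigcup chainQ.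
exists (G `|` F); split=> // N hN GFN NI.
have [->|nGN] := pselect (G = N); first by move=> c Nc; left.
(* Since N contains F, N ∪ F is N itself, so N belongs to the family and contradicts the maximality
   of G. *)
have FN : F `<=` N by move=> a Fa; apply: GFN; right.
have GN : G `<` N.
  have GN a : G a -> N a by move=> Ga; apply: GFN; left.
  by split=> // NG; apply: nGN; apply/seteqP.
by case: (Gmax N GN); split; rewrite (setUidl FN).
Qed.

(** A filter maximal among those disjoint from I is prime: if it omits a and b, enlarging it by
    either one meets I, and distributivity then puts a join of two elements of I into it as soon as
    it contains the join of a and b. *)
Lemma prime_separation F (I : set A) :
  lattice_filter F -> lattice_ideal I -> F `&` I = set0 ->
  exists x : Spec A, F `<=` spec_filter x /\ spec_filter x `&` I = set0.
Proof.
move=> hF hI /(maximal_disjoint_lfilter hF)[M [hM FM MI Mmax]].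
have meets_ideal a : ~ M a -> exists m i, [/\ M m, I i & (m `&` a)%O <= i].
  move=> nMa; apply: contrapT => none; apply: nMa.
  have hp := principal_lfilter a.
  apply: (Mmax (filter_join M [set c | a <= c])); first exact: filter_join_lfilter.
  - exact: sub_filter_joinl.
  - apply/seteqP; split=> // c [[m [g [Mm ag mgc]]] Ic].
    apply: none; exists m, c; split=> //; apply: le_trans mgc.
    exact: leI2.
  - by apply: sub_filter_joinr => //=.
suff Mprime : prime_filter M by exists (MkSpec Mprime).
split=> //.
(* The goal [False] is read as membership in [set0], which is then rewritten into M ∩ I. *)
- by move=> Mbot; rewrite -[False]/(set0 (\bot : A)) -MI; split=> //; exact: lideal_bot.
move=> a b Mab; apply: contrapT => /not_orP[nMa nMb].
have [m [i [Mm Ii mai]]] := meets_ideal _ nMa.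
have [n [j [Mn Ij nbj]]] := meets_ideal _ nMb.
rewrite -[False]/(set0 (i `|` j)%O) -MI; split; last exact: lideal_join.
apply: (lfilter_up hM) (lfilter_meet hM (lfilter_meet hM Mm Mn) Mab).
apply: meet_join_le.
- by apply: le_trans (leUl _ _); apply: le_trans mai; rewrite leI2// leIl.
- by apply: le_trans (leUr _ _); apply: le_trans nbj; rewrite leI2// leIr.
Qed.

Lemma prime_extension F b : lattice_filter F -> ~ F b ->
  exists x : Spec A, F `<=` spec_filter x /\ ~ spec_filter x b.
Proof.
move=> hF nFb.
have hI : lattice_ideal [set c | c <= b].
  by split=> [|a c ac cb|a c ab cb] /=;
    [exact: le0x|exact: le_trans cb|rewrite leUx; apply/andP].
have [|x [Fx xI]] := prime_separation hF hI.
  by apply/seteqP; split=> // c [Fc cb]; apply: nFb; exact: lfilter_up cb _.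
exists x; split=> // xb.
by rewrite -[False]/(set0 b) -xI; split=> /=.
Qed.

Lemma spec_lfilter (x : Spec A) : lattice_filter (spec_filter x).
Proof. by have [] := spec_filter_prime x. Qed.

(** If the filter generated by z and a contained b, residuation would put [himp a b] in z; otherwise
    it extends to a prime filter omitting b. *)
Lemma spec_himp_witness (z : Spec A) a b : ~ spec_filter z (himp a b) ->
  exists z', [/\ spec_le z z', spec_filter z' a & ~ spec_filter z' b].
Proof.
move=> nzab; have hz := spec_lfilter z; have ha := principal_lfilter a.
have [|z' [sub nb]] := prime_extension (filter_join_lfilter hz ha) (b := b).
  move=> [f [g [zf ag fgb]]]; apply: nzab; apply/(lfilter_himpP _ _ hz).
  by exists f => //; apply: le_trans fgb; rewrite leI2.
exists z'; split=> //; first by move=> c zc; apply: sub; exact: sub_filter_joinl.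
by apply: sub; apply: sub_filter_joinr => //=.
Qed.

(** As a left adjoint, [pdia] preserves bottom and binary joins; primeness of z then gives closure
    under joins. *)
Lemma pdia_ideal (z : Spec A) : lattice_ideal [set a | ~ spec_filter z (pdia a)].
Proof.
have [hz zbot zprime] := spec_filter_prime z; split=> /=.
- by move=> /(lfilter_up hz pdia_bot_le).
- by move=> a b ab nzb /(lfilter_up hz (pdia_mono ab)).
- by move=> a b nza nzb /(lfilter_up hz (pdia_join_le a b))/zprime[].
Qed.

(** Read contrapositively, [spec_Rpast z w] says that w is disjoint from the ideal of [pdia_ideal],
    so prime separation yields w. *)
Lemma Rpast_extension F (z : Spec A) : lattice_filter F ->
  (forall a, F a -> spec_filter z (pdia a)) ->
  exists w, spec_Rpast z w /\ F `<=` spec_filter w.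
Proof.
move=> hF Fz; have [|w [Fw wI]] := prime_separation hF (pdia_ideal z).
  by apply/seteqP; split=> // a [/Fz ? /=].
exists w; split=> // a wa; apply: contrapT => nza.
by rewrite -[False]/(set0 a) -wI.
Qed.

End PrimeSeparation.

(** * Congruences correspond to P-filters *)

Section CongruencesAndPFilters.
Context {d : Order.disp_t} {A : temporalHeytingType d}.
Implicit Types (a b c : A) (F : set A) (th : A -> A -> Prop).

Definition cong_of_filter F a b := F (himp a b) /\ F (himp b a).

(** Each operation is first treated for one-sided implication modulo F, with [himp] contravariant in
    its first argument; symmetrizing gives the congruence. For [pdia] this is the P-filter condition
    itself. *)
Lemma P_filter_cong F : P_filter F -> congruence (cong_of_filter F).
Proof.
move=> [hF PF]; have impP a b := lfilter_himpP a b hF.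
have trans a b c : F (himp a b) -> F (himp b c) -> F (himp a c).
  move=> /impP[f Ff fab] /impP[g Fg gbc]; apply/impP.
  exists (g `&` f)%O; first exact: lfilter_meet.
  by rewrite -meetA; apply: le_trans gbc; rewrite leI2.
have meet a a' b b' : F (himp a a') -> F (himp b b') ->
    F (himp (a `&` b)%O (a' `&` b')%O).
  move=> /impP[f Ff fa] /impP[g Fg gb]; apply/impP.
  exists (f `&` g)%O; first exact: lfilter_meet.
  by rewrite meetACA leI2.
have join a a' b b' : F (himp a a') -> F (himp b b') ->
    F (himp (a `|` b)%O (a' `|` b')%O).
  move=> /impP[f Ff fa] /impP[g Fg gb]; apply/impP.
  exists (f `&` g)%O; first exact: lfilter_meet.
  apply: meet_join_le.
  - by apply: le_trans (leUl _ _); apply: le_trans fa; rewrite leI2// leIl.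
  - by apply: le_trans (leUr _ _); apply: le_trans gb; rewrite leI2// leIr.
have imp a a' b b' : F (himp a' a) -> F (himp b b') ->
    F (himp (himp a b) (himp a' b')).
  move=> /impP[f Ff fa] /impP[g Fg gb]; apply/impP.
  exists (g `&` f)%O; first exact: lfilter_meet.
  rewrite -himpP; apply: le_trans gb; rewrite -!meetA leI2//.
  apply: le_trans (himp_mp a b); rewrite meetCA leI2//.
(* The parameter f passes under the box because f <= [box f] and [box] preserves meets. *)
have bx a b : F (himp a b) -> F (himp (box a) (box b)).
  move=> /impP[f Ff fab]; apply/impP; exists f => //.
  by apply: le_trans (box_mono fab); rewrite boxI leI2// le_box.
split.
- by move=> a; split; apply/impP; exists \top; rewrite ?leIr//; exact: lfilter_top.
- by move=> a b [].
- by move=> a b c [ab ba] [bc cb]; split; [exact: (trans _ b)|exact: (trans _ b)].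
- by move=> a a' b b' [? ?] [? ?]; split; exact: meet.
- by move=> a a' b b' [? ?] [? ?]; split; exact: join.
- by move=> a a' b b' [? ?] [? ?]; split; exact: imp.
- by move=> a a' [? ?]; split; exact: bx.
- by move=> a a' [? ?]; split; exact: PF.
Qed.

Lemma cong_of_filter_top F a : lattice_filter F ->
  cong_of_filter F a \top <-> F a.
Proof.
move=> hF; split=> [[_ h]|Fa]; first exact: (lfilter_mp hF h) (lfilter_top hF).
split; last exact: lfilter_up (le_himp _ _) Fa.
by apply: lfilter_up (le_himp _ _) _ => //; exact: lfilter_top.
Qed.

Lemma cong_P_filter th : congruence th -> P_filter [set a | th a \top].
Proof.
move=> hth; split; first split=> /=.
- exact: cong_refl.
- move=> a b /join_idPl ab ta.
  have := cong_join hth ta (cong_refl hth b); rewrite join1x.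
  by rewrite joinC ab.
- by move=> a b ta tb; have := cong_meet hth ta tb; rewrite meet1x.
move=> a b /= tab.
(* Meeting [himp a b] ~ 1 with a gives a ∧ b ~ a. Hence [himp (pdia a) (pdia b)] is congruent to the
   same implication from [pdia] of a ∧ b, which is [\top] by monotonicity. *)
have aab : th (a `&` b)%O a.
  by have := cong_meet hth tab (cong_refl hth a); rewrite meet1x himp_meet.
have := cong_himp hth (cong_sym hth (cong_pdia hth aab)) (cong_refl hth (pdia b)).
by have /himp_topP -> : pdia (a `&` b)%O <= pdia b by rewrite pdia_mono ?leIr.
Qed.

(** Meeting the two implications with a and b shows both elements congruent to a ∧ b; hence a
    congruence is recovered from the class of [\top]. *)
Lemma congP th a b : congruence th ->
  th a b <-> th (himp a b) \top /\ th (himp b a) \top.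
Proof.
move=> hth; have himpxx c : himp c c = \top by apply/himp_topP.
split=> [tab|[tab tba]].
  split; first by rewrite -(himpxx b); apply: cong_himp => //; exact: cong_refl.
  by rewrite -(himpxx a); apply: cong_himp => //; [exact: cong_sym|exact: cong_refl].
have ta := cong_meet hth tab (cong_refl hth a).
have tb := cong_meet hth tba (cong_refl hth b).
rewrite meet1x himp_meet in ta; rewrite meet1x himp_meet meetC in tb.
exact: (cong_trans hth) (cong_sym hth ta) tb.
Qed.

Lemma P_filter_top : P_filter [set (\top : A)].
Proof.
split; first split=> //=.
- by move=> a b ab aT; rewrite aT le1x in ab; exact/eqP.
- by move=> a b -> ->; rewrite meetx1.
- by move=> a b /= /himp_topP ab; apply/himp_topP/pdia_mono.
Qed.

Lemma P_filter_setT : P_filter (setT : set A).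
Proof. by split. Qed.

Lemma simple_P_filter : simple_algebra A <->
  [set F : set A | P_filter F] = [set [set \top]; setT].
Proof.
split=> [sA|fA].
  apply/seteqP; split=> F /=; last first.
    by move=> [->|->]; [exact: P_filter_top|exact: P_filter_setT].
  move=> PF; have topF a := cong_of_filter_top a PF.1.
  have : [set th : A -> A -> Prop | congruence th] (cong_of_filter F).
    exact: P_filter_cong.
  rewrite sA => -[FE|FE]; [left|right]; apply/seteqP; split=> a //=.
  - by move=> /topF; rewrite FE.
  - by move=> ->; apply: lfilter_top; case: PF.
  - by move=> _; apply/topF; rewrite FE.
apply/seteqP; split=> th /=; last first.
  by move=> [->|->]; split=> //; [move=> a b c -> ->|..]; move=> *; subst.
move=> hth; have := cong_P_filter hth; have thP a b := congP a b hth.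
set F := [set a | _] => PF.
have : [set F : set A | P_filter F] F by [].
rewrite fA => -[FE|FE]; [left|right]; apply/funext => a; apply/funext => b;
  apply/propext.
  split=> [/thP[]|->]; last exact: cong_refl.
  rewrite -[th _ _]/(F _) -[th (himp b a) _]/(F _) FE => /himp_topP ab /himp_topP ba.
  by apply: le_anti; rewrite ab.
split=> // _; apply/thP; rewrite -[th _ _]/(F _) -[th (himp b a) _]/(F _) FE.
by [].
Qed.

End CongruencesAndPFilters.

(** * P-filters correspond to closed archival upsets *)

Section SpectrumAndPFilters.
Context {d : Order.disp_t} {A : temporalHeytingType d}.
Implicit Types (a b c : A) (F : set A) (x y z w : Spec A) (S : set (Spec A)).

(** Finitely many subbasic sets reduce to one pair: the positive ones are collected in a meet a, the
    complements in a join b, which y omits by primeness. *)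
Lemma spec_subbase_seq y (s : seq (set (Spec A))) :
  (forall U, U \in s -> U y /\ spec_subbase U) ->
  exists a b, [/\ spec_filter y a, ~ spec_filter y b &
    forall x, spec_filter x a -> ~ spec_filter x b ->
      forall U, U \in s -> U x].
Proof.
elim: s => [_|U s IH sub].
  exists \top, \bot; split=> //; first exact: lfilter_top (spec_lfilter y).
  by have [] := spec_filter_prime y.
have [V Vs|a [b [ya yb ab]]] := IH; first by apply: sub; rewrite inE Vs orbT.
have [Uy [c Uc]] := sub U (mem_head _ _).
case: Uc Uy => {sub} -> Uy.
- exists (a `&` c)%O, b; split=> //; first exact: (lfilter_meet (spec_lfilter y)).
  move=> x xac xb V; rewrite inE => /predU1P[->|]; last first.
    by apply: ab => //; exact: (lfilter_up (spec_lfilter x) (leIl _ _) xac).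
  exact: (lfilter_up (spec_lfilter x) (leIr _ _) xac).
- exists a, (b `|` c)%O; split=> //.
    by have [_ _ yprime] := spec_filter_prime y => /yprime[].
  move=> x xa xbc V; rewrite inE => /predU1P[->|].
    by move=> xc; apply: xbc; exact: (lfilter_up (spec_lfilter x) (leUr _ _) xc).
  apply: ab => // xb; apply: xbc.
  exact: (lfilter_up (spec_lfilter x) (leUl _ _) xb).
Qed.

Lemma spec_open_basic S y : open S -> S y ->
  exists a b, [/\ spec_filter y a, ~ spec_filter y b &
    forall x, spec_filter x a -> ~ spec_filter x b -> S x].
Proof.
move=> [D DB <-] [B DB' yB]; have [E ED BE] := DB _ DB'.
have [U UE|a [b [ya yb ab]]] := @spec_subbase_seq y (enum_fset E).
  split; last exact: set_mem (ED _ UE).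
  by move: yB; rewrite -BE; exact.
exists a, b; split=> // x xa xb; exists B => //; rewrite -BE.
exact: ab xa xb.
Qed.

Lemma spec_pi_closed a : closed (spec_pi a).
Proof.
rewrite -openC; exists [set ~` spec_pi a]; last by rewrite bigcup_set1.
move=> _ ->; exists [fset (~` spec_pi a)]%fset; last by rewrite set_fset1 bigcap_set1.
by move=> U; rewrite in_fset1 => /eqP ->; apply: mem_set; exists a; right.
Qed.

Definition filter_of_spec S : set A := [set a | S `<=` spec_pi a].

Lemma filter_of_spec_lfilter S : lattice_filter (filter_of_spec S).
Proof.
split=> [x Sx|a b ab Sa x Sx|a b Sa Sb x Sx]; have hx := spec_lfilter x.
- exact: (lfilter_top hx).
- exact: (lfilter_up hx ab (Sa x Sx)).
- exact: (lfilter_meet hx (Sa x Sx) (Sb x Sx)).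
Qed.

(** A failure of the implication at x is witnessed by a point above x, which still lies in the upset
    S. *)
Lemma filter_of_spec_himp S a b : upset spec_le S ->
  (forall x, S x -> spec_filter x a -> spec_filter x b) ->
  filter_of_spec S (himp a b).
Proof.
move=> upS Sab x Sx; apply: contrapT => /spec_himp_witness[x' [xx' x'a]]; apply.
by apply: Sab => //; exact: upS xx' Sx.
Qed.

Lemma filter_of_spec_P_filter S : archival spec_le spec_Rpast S ->
  upset spec_le S -> P_filter (filter_of_spec S).
Proof.
move=> arS upS; split; first exact: filter_of_spec_lfilter.
move=> a b Sab; apply: filter_of_spec_himp => // z Sz za.
have [|w [zw aw]] := Rpast_extension (z := z) (principal_lfilter a).
  by move=> c /= ac; exact: (lfilter_up (spec_lfilter z) (pdia_mono ac) za).
(* The successor w may lie outside S; archivality replaces it by a successor of z above w inside S,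
   where a and [himp a b] both hold. *)
have [y [zy wy Sy]] : exists y, [/\ spec_Rpast z y, spec_le w y & S y].
  have [Sw|nSw] := pselect (S w); first by exists w; split.
  by have [y [[? ?] ?]] := arS _ _ nSw Sz zw; exists y.
apply: zy; apply: (lfilter_mp (spec_lfilter y) (Sab _ Sy) _).
by apply: wy; apply: aw => /=.
Qed.

(** Makes S recoverable from its filter, so that knowing all P-filters determines all closed
    archival upsets. *)
Lemma closed_upset_filter_of_spec S : closed S -> upset spec_le S ->
  S = [set x | filter_of_spec S `<=` spec_filter x].
Proof.
move=> clS upS; apply/seteqP; split=> [x Sx a|y Fy] /=; first exact.
apply: contrapT => nSy.
have [a [b [ya yb ab]]] := spec_open_basic (closed_openC clS) nSy.
apply: yb; apply: (lfilter_mp (spec_lfilter y) (Fy (himp a b) _) ya).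
apply: filter_of_spec_himp => // x Sx xa.
by apply: contrapT => /(ab _ xa).
Qed.

Definition spec_of_filter F : set (Spec A) := [set x | F `<=` spec_filter x].

Lemma spec_of_filter_closed F : closed (spec_of_filter F).
Proof.
suff -> : spec_of_filter F = \bigcap_(a in F) spec_pi a.
  by apply: closed_bigI => a _; exact: spec_pi_closed.
by apply/seteqP; split=> x xF a Fa; exact: xF.
Qed.

Lemma spec_of_filter_upset F : upset spec_le (spec_of_filter F).
Proof. by move=> x y xy Fx a /Fx /xy. Qed.

Lemma spec_of_filter_archival F : P_filter F ->
  archival spec_le spec_Rpast (spec_of_filter F).
Proof.
move=> [hF PF] x z _ Fz zx; have hx := spec_lfilter x.
have [|y [zy Fxy]] := Rpast_extension (z := z) (filter_join_lfilter hF hx).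
  (* From f ∧ c <= a, F contains [himp c a], hence [himp (pdia c) (pdia a)]; this lies in z, as does
     [pdia c]. *)
  move=> a [f [c [Ff xc fca]]].
  apply: (lfilter_mp (spec_lfilter z) _ (zx _ xc)); apply: Fz; apply: PF.
  by apply/(lfilter_himpP _ _ hF); exists f.
exists y; split; first split=> //=.
- by move=> a xa; apply: Fxy; exact: sub_filter_joinr.
- by move=> a Fa; apply: Fxy; exact: sub_filter_joinl.
Qed.

Lemma P_filter_topo_connected :
  [set F : set A | P_filter F] = [set [set \top]; setT] <->
  topo_connected (X := Spec A) spec_le spec_Rpast.
Proof.
split=> [fA x y S clS arS upS Sx|conn].
  have : [set F : set A | P_filter F] (filter_of_spec S).
    exact: filter_of_spec_P_filter.
  rewrite fA => -[FE|FE].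
    (* When the filter of S is {1}, every prime filter contains it and S is the whole space; when it
       is A, the point x of S would contain [\bot]. *)
    rewrite (closed_upset_filter_of_spec clS upS) FE => _ ->.
    exact: (lfilter_top (spec_lfilter y)).
  have [_ xbot _] := spec_filter_prime x; exfalso; apply: xbot.
  by have /(_ x Sx) : filter_of_spec S \bot by rewrite FE.
apply/seteqP; split=> F /=; last first.
  by move=> [->|->]; [exact: P_filter_top|exact: P_filter_setT].
move=> PF; have [hF _] := PF.
have [Fbot|nFbot] := pselect (F \bot).
  by right; apply/seteqP; split=> // a _; apply: (lfilter_up hF (le0x a) Fbot).
left; apply/seteqP; split=> a /=; last by move=> ->; exact: (lfilter_top hF).
(* For a proper F containing some a other than [\top], x contains F and some y omits a; the closed
   archival upset of F then separates x from y. *)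
move=> Fa; have [x [Fx _]] := prime_extension hF nFbot.
apply: contrapT => naT.
have [hT _] := @P_filter_top _ A.
have [y [_]] := prime_extension hT naT; apply.
have Fy : spec_of_filter F y.
  apply: (conn x y) => //; first exact: spec_of_filter_closed.
  - exact: spec_of_filter_archival.
  - exact: spec_of_filter_upset.
exact: Fy.
Qed.

End SpectrumAndPFilters.

Theorem theorem5p1 (d : Order.disp_t) (A : temporalHeytingType d) :
  [<-> simple_algebra A;
       [set F : set A | P_filter F] = [set [set \top]; setT];
       topo_connected (X := Spec A) spec_le spec_Rpast].
Proof.
tfae.
- by move/simple_P_filter.
- by move/P_filter_topo_connected.
- by move/P_filter_topo_connected/simple_P_filter.
Qed.
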